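(* For the minimal signed Petersen graphs and their negatives: $+P$ and $-P$ are clusterable with $\operatorname{clu}(+P)=1$, $\operatorname{clu}(-P)=3$; $P_1$, $P_{2,2}$, $P_{2,3}$, $P_{3,2}$, $P_{3,3}$ are not clusterable, while $-P_1$, $-P_{2,2}$, $-P_{2,3}$, $-P_{3,2}$, $-P_{3,3}$ are clusterable with $\operatorname{clu}(-P_1)=3$, $\operatorname{clu}(-P_{2,2})=3$, $\operatorname{clu}(-P_{2,3})=3$, $\operatorname{clu}(-P_{3,2})=4$, $\operatorname{clu}(-P_{3,3})=2$. The inclusterability indices are $Q(+P)=Q(-P)=0$, $Q(P_1)=1$, $Q(P_{2,2})=2$, $Q(P_{2,3})=2$, $Q(P_{3,2})=3$, $Q(P_{3,3})=3$, and $Q(-P_1)=Q(-P_{2,2})=Q(-P_{2,3})=Q(-P_{3,2})=Q(-P_{3,3})=0$.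
   Context: The Petersen graph $P$ has vertices $v_{ij}$ for the 2-element subsets $\{i,j\}\subseteq\{1,\dots,5\}$, with $v_{ij}v_{kl}$ an edge iff $\{i,j\}\cap\{k,l\}=\emptyset$. For a signed graph $\Sigma$, $-\Sigma$ is its negation (all signs reversed). $\Sigma$ is clusterable if $V$ can be partitioned into nonempty clusters with every edge inside a cluster positive and every edge between clusters negative; $\operatorname{clu}(\Sigma)$ is the least number of clusters; $Q(\Sigma)$ is the least number of edges whose deletion leaves a clusterable signed graph. Edge distance is distance in the line graph; disjoint edges of $P$ have distance 2 if some edge joins them, 3 otherwise. $+P$: all edges positive; $-P$: all negative; $P_1$: one negative edge; $P_{2,2}$/$P_{2,3}$: exactly two negative edges at distance 2/3; $P_{3,2}$: exactly three negative edges forming alternate edges of a 6-cycle; $P_{3,3}$: exactly three negative edges pairwise at distance 3. *)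

(* Defs.v *)
From HB Require Import structures.
From mathcomp Require Import all_boot.

Set Implicit Arguments.
Unset Strict Implicit.
Unset Printing Implicit Defensive.

Section SignedGraphs.
Variable V : finType.

(* Edges are two-element vertex sets; an edge is positive when it is not in
   [negative]. *)
Record signed_graph := SignedGraph {
  edges : {set {set V}};
  negative : {set {set V}};
  edges_card2 : forall e, e \in edges -> #|e| = 2;
  negative_sub : negative \subset edges
}.

Implicit Types (S : signed_graph) (C D : {set {set V}}).

Definition negate S : signed_graph :=
  SignedGraph (@edges_card2 S) (subsetDl (edges S) (negative S)).

Lemma delete_card2 S D e : e \in edges S :\: D -> #|e| = 2.
Proof. by case/setDP=> eS _; apply: edges_card2 eS. Qed.

Definition delete S D : signed_graph :=
  SignedGraph (@delete_card2 S D) (setSD D (negative_sub S)).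

(* [partition] already excludes empty blocks. *)
Definition clustering S C : bool :=
  partition C [set: V] &&
  [forall e in edges S, (e \notin negative S) == [exists A in C, e \subset A]].

Definition clusterable S : bool := [exists C, clustering S C].

(* Junk value 0 when [S] is not clusterable. *)
Definition clu S : nat :=
  if [pick C | clustering S C] is Some C0
  then #|[arg min_(C < C0 | clustering S C) #|C|]| else 0.

(* Deleting all the edges always works, so this is a genuine minimum. *)
Definition inclusterability S : nat :=
  #|[arg min_(D < edges S | (D \subset edges S) && clusterable (delete S D))
      #|D|]|.

Lemma cluP S : clusterable S ->
  (exists2 C, clustering S C & #|C| = clu S) /\
  (forall C, clustering S C -> clu S <= #|C|).
Proof.
case/existsP=> C1 C1S; rewrite /clu; case: pickP => [C0 C0S|/(_ C1)]; last first.
  by rewrite C1S.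
by case: arg_minnP => // C CS Cmin; split; first by exists C.
Qed.

Lemma inclusterabilityP S :
  (exists D, [/\ D \subset edges S, clusterable (delete S D)
               & #|D| = inclusterability S]) /\
  (forall D, D \subset edges S -> clusterable (delete S D) ->
     inclusterability S <= #|D|).
Proof.
rewrite /inclusterability; case: arg_minnP => [|D /andP[DS DC] Dmin].
  rewrite subxx; apply/existsP; exists (preim_partition id [set: V]).
  rewrite /clustering preim_partitionP.
  by apply/forallP=> e /=; rewrite setDv inE.
by split=> [|D' D'S D'C]; [exists D | apply: Dmin; rewrite D'S].
Qed.

End SignedGraphs.

(* Least length of an [r]-walk from [x] to [y]; its value is #|T| when there
   is no walk, as a shortest walk has length less than #|T|. *)
Definition graph_distance (T : finType) (r : rel T) (x y : T) : nat :=
  find (fun n => [exists p : n.-tuple T, path r x p && (last x p == y)])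
       (iota 0 #|T|).

Lemma graph_distance_walk (T : finType) (r : rel T) (x y : T) :
  connect r x y ->
  exists p, [/\ path r x p, last x p = y & size p = graph_distance r x y].
Proof.
case/connectP=> p0 p0r ->; case/shortenP: p0r => p rp up _.
rewrite /graph_distance; set a := (X in find X _).
have hasa : has a (iota 0 #|T|).
  apply/hasP; exists (size p).
    by rewrite mem_iota /= add0n -[_.+1]/(size (x :: p)) -(card_uniqP up) max_card.
  by apply/existsP; exists (in_tuple p); rewrite rp eqxx.
have := nth_find 0 hasa; rewrite nth_iota; last by rewrite -[ltnRHS](size_iota 0) -has_find.
case/existsP=> q /andP[rq /eqP qy]; exists q.
by rewrite size_tuple.
Qed.

Lemma graph_distance_le (T : finType) (r : rel T) (x : T) p :
  path r x p -> graph_distance r x (last x p) <= size p.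
Proof.
move=> rp; rewrite /graph_distance; set a := (X in find X _).
have [ltp|] := ltnP (size p) #|T|; last first.
  by apply: leq_trans; rewrite -[leqRHS](size_iota 0) find_size.
rewrite leqNgt; apply/negP=> /(before_find 0); rewrite nth_iota // add0n.
by move/existsP; case; exists (in_tuple p); rewrite rp eqxx.
Qed.

Definition line_adj (V : finType) (E : {set {set V}}) : rel {set V} :=
  fun e f => [&& e \in E, f \in E, e != f & e :&: f != set0].

Definition edge_distance (V : finType) (E : {set {set V}}) (e f : {set V}) :=
  graph_distance (line_adj E) e f.

Definition petersen_vertex : finType := {A : {set 'I_5} | #|A| == 2}.

Definition petersen_adj : rel petersen_vertex :=
  fun u v => [disjoint val u & val v].

Definition petersen_edges : {set {set petersen_vertex}} :=
  [set [set uv.1; uv.2] | uv : petersen_vertex * petersen_vertex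
                        & petersen_adj uv.1 uv.2].

Lemma petersen_edges_card2 e : e \in petersen_edges -> #|e| = 2.
Proof.
case/imsetP=> -[u v]; rewrite inE /= => uv ->; rewrite cards2.
case: eqP uv => // <-; rewrite /petersen_adj -setI_eq0 setIid => /eqP u0.
by have := valP u; rewrite u0 cards0.
Qed.

Definition plusP : signed_graph petersen_vertex :=
  SignedGraph petersen_edges_card2 (sub0set petersen_edges).

Definition minusP : signed_graph petersen_vertex :=
  SignedGraph petersen_edges_card2 (subxx petersen_edges).

(* Each of the following signed graphs is determined only up to the choice of
   its negative edges, hence the predicates. *)
Section MinimalSignings.
Variable S : signed_graph petersen_vertex.

Definition is_P1 : Prop :=
  edges S = petersen_edges /\ #|negative S| = 1.

Definition is_P2 (d : nat) : Prop :=
  edges S = petersen_edges /\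
  exists e f, [/\ negative S = [set e; f], e != f
                & edge_distance petersen_edges e f = d].

Definition is_P32 : Prop :=
  edges S = petersen_edges /\
  exists a b c d e f : petersen_vertex,
    ucycle petersen_adj [:: a; b; c; d; e; f] /\
    negative S = [set [set a; b]; [set c; d]; [set e; f]].

Definition is_P33 : Prop :=
  edges S = petersen_edges /\ #|negative S| = 3 /\
  {in negative S &, forall e f, e != f -> edge_distance petersen_edges e f = 3}.

End MinimalSignings.

(* Main.v *)
(* A clustering with k clusters is a map from the vertices to k colours under
   which the positive edges are exactly the monochromatic ones.  Numbering the
   vertices of P turns both the search for such maps and the computation of the
   components of the positive subgraph into evaluations on lists.  With N the
   negative set, Q <= #|N| since deleting N leaves a single cluster, and
   Q >= #|N| since after deleting any fewer edges some negative edge still has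
   both ends in one positive component. *)

Require Import Defs.
From mathcomp Require Import all_boot.

Set Implicit Arguments.
Unset Strict Implicit.
Unset Printing Implicit Defensive.

(** * Clusterings as colourings *)

Lemma eq_set2 (T : finType) (a b c d : T) :
  ([set a; b] == [set c; d]) = ((a, b) == (c, d)) || ((b, a) == (c, d)).
Proof.
apply/eqP/orP => [E|]; last by case=> /eqP[-> ->]; rewrite // setUC.
have := set21 c d; have := set22 c d; rewrite -E !in_set2.
have := set21 a b; have := set22 a b; rewrite {1 2}E !in_set2.
case/orP=> /eqP-> /orP[] /eqP->; rewrite ?eqxx; try by [left | right].
- by rewrite !orbb => /eqP-> _; left.
- by rewrite !orbb => _ /eqP->; left.
Qed.

Section Colouring.
Variable V : finType.
Implicit Types (S : signed_graph V) (C D : {set {set V}}).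

(** The colour type is arbitrary so that a vertex may also be coloured by its own block, with
    [pblock C] as the colouring. *)
Definition colouring (T : eqType) S (f : V -> T) :=
  forall u v, [set u; v] \in edges S ->
    ([set u; v] \notin negative S) = (f u == f v).

Lemma clustering_pblock S C : clustering S C -> colouring S (pblock C).
Proof.
case/andP=> /and3P[/eqP covC tiC _] /forall_inP CS u v uvS.
have inC x : x \in cover C by rewrite covC inE.
rewrite (eqP (CS _ uvS)); apply/exists_inP/eqP => [[A AC]|uv].
  rewrite subUset !sub1set => /andP[uA vA].
  by rewrite !(def_pblock tiC AC).
exists (pblock C u); first by rewrite pblock_mem.
by rewrite subUset !sub1set {2}uv !mem_pblock !inC.
Qed.

Lemma clustering_colouring S C :
  clustering S C -> exists f : V -> 'I_#|C|, colouring S f.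
Proof.
move=> CS; have [/and3P[/eqP covC _ _] _] := andP CS.
have inC x : pblock C x \in C by rewrite pblock_mem // covC inE.
exists (fun u => enum_rank_in (inC u) (pblock C u)) => u v uvS.
rewrite (clustering_pblock CS uvS); apply/eqP/eqP => [uv|/(congr1 enum_val)].
  by apply: enum_val_inj; rewrite !enum_rankK_in ?inC.
by rewrite !enum_rankK_in.
Qed.

(** The clusters are the nonempty fibres of [f]; colours without a vertex give no cluster, hence an
    inequality. *)
Lemma colouring_clustering S k (f : V -> 'I_k) :
  colouring S f -> exists2 C, clustering S C & #|C| <= k.
Proof.
move=> fS; exists (preim_partition f [set: V]).
  rewrite /clustering preim_partitionP /=; apply/forall_inP=> e eS.
  have /eqP/cards2P[u [v [_ e_uv]]] := edges_card2 eS; rewrite {}e_uv in eS *.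
  rewrite fS //; apply/eqP; apply/eqP/exists_inP => [fuv|[A /imsetP[x _ ->]]].
    exists [set y in [set: V] | f u == f y].
      apply: (imset_f (fun x => [set y in [set: V] | f x == f y])).
      by rewrite inE.
    by rewrite subUset !sub1set !inE fuv eqxx.
  by rewrite subUset !sub1set !inE => /andP[/eqP<- /eqP<-].
rewrite (_ : preim_partition _ _ =
  [set [set y | i == f y] | i in f @: [set: V]]).
  by rewrite (leq_trans (leq_imset_card _ _)) // -[leqRHS]card_ord max_card.
rewrite -imset_comp; apply: eq_imset => x.
by apply/setP=> y; rewrite !inE.
Qed.

Lemma clu_colouring S k :
    (exists f : V -> 'I_k, colouring S f) ->
    (forall m (f : V -> 'I_m), m < k -> ~ colouring S f) ->
  clusterable S /\ clu S = k.
Proof.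
move=> [f fS] min_k; have [C CS leCk] := colouring_clustering fS.
have clS : clusterable S by apply/existsP; exists C.
split=> //; have [[C' C'S cardC'] min_clu] := cluP clS.
have [g gS] := clustering_colouring C'S.
apply/eqP; rewrite eqn_leq (leq_trans (min_clu C CS)) //= -cardC' leqNgt.
by apply/negP=> /min_k /(_ gS).
Qed.

Lemma clusterable_inclusterability S :
  clusterable S = (inclusterability S == 0).
Proof.
(* The two graphs carry different proofs, but [clustering] reads only their edge and negative
   sets. *)
have del0 : clusterable (delete S set0) = clusterable S.
  by rewrite /clusterable /clustering /= !setD0.
have [[D [_ DS cardD]] minQ] := inclusterabilityP S.
apply/idP/eqP => [clS|Q0].
  by apply/eqP; rewrite -leqn0 -(cards0 {set V}) minQ ?sub0set ?del0.
move: DS cardD; rewrite Q0 => DS /eqP; rewrite cards_eq0 => /eqP D0.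
by rewrite -del0 -D0.
Qed.

Lemma inclusterability_negative S : inclusterability S <= #|negative S|.
Proof.
have [_ minQ] := inclusterabilityP S; apply: minQ (negative_sub S) _.
have [|C CS _] := @colouring_clustering (delete S (negative S)) 1 (fun=> ord0).
  by move=> u v; rewrite !inE eqxx andNb.
by apply/existsP; exists C.
Qed.

End Colouring.

(** * Numbering of the vertices and edges of P *)

(* Vertices are numbered 0, ..., 9 in the order of [pairs] (two-element subsets
   of {0, ..., 4}); [arcs] lists the edges of P under this numbering. *)
Definition pairs : seq (nat * nat) :=
  [seq (i, j) | i <- iota 0 5, j <- iota i.+1 (4 - i)].

Definition arcs : seq (nat * nat) :=
  [:: (0, 7); (0, 8); (0, 9); (1, 5); (1, 6); (1, 9); (2, 4); (2, 6); (2, 8);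
      (3, 4); (3, 5); (3, 7); (4, 9); (5, 8); (6, 7)].

Definition linked i j := ((i, j) \in arcs) || ((j, i) \in arcs).

Definition vertex0 : petersen_vertex :=
  @Sub _ _ petersen_vertex [set ord0; ord_max] (introT eqP (cards2 _ _)).

Definition pair k := nth (0, 1) pairs k.

(** Beyond index 9, [pair] takes its default [(0, 1)], so [vertex] repeats vertex 0; this is why
    injectivity and adjacency are stated below 10. *)
Definition vertex k : petersen_vertex :=
  insubd vertex0 [set inord (pair k).1; inord (pair k).2].

Definition edge (p : nat * nat) : {set petersen_vertex} :=
  [set vertex p.1; vertex p.2].

Lemma eq_inord n i j :
  i <= n -> j <= n -> (inord i == inord j :> 'I_n.+1) = (i == j).
Proof. by move=> lin ljn; rewrite -val_eqE /= !inordK. Qed.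

Lemma pairsP p : (p \in pairs) = (p.1 < p.2 < 5).
Proof.
case: p => i j /=; apply/allpairsPdep/idP
  => [[x [y [+ + [-> ->]]]]|/andP[ltij ltj5]].
  by rewrite !mem_iota /= add0n => ltx5; rewrite addSn subnKC.
have lti5 := ltn_trans ltij ltj5.
by exists i, j; rewrite !mem_iota /= add0n addSn subnKC // ltij.
Qed.

Lemma val_vertex k : k < 10 ->
  val (vertex k) = [set inord (pair k).1; inord (pair k).2].
Proof.
move=> lk; have := mem_nth (0, 1) (lk : k < size pairs).
rewrite -/(pair k) pairsP => /andP[l12 l2].
rewrite insubdK // unfold_in cards2 eq_inord ?neq_ltn ?l12 // -ltnS.
exact: ltn_trans l2.
Qed.

Lemma vertexP v : exists2 k, k < 10 & v = vertex k.
Proof.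
have /cards2P[i [j [neq_ij v_ij]]] := valP v.
wlog ltij: i j neq_ij v_ij / i < j.
  move=> wlg; have [|/wlg|/val_inj/eqP] := ltngtP i j; first exact: wlg.
    by rewrite eq_sym setUC; apply.
  by rewrite (negPf neq_ij).
have ijP : (val i, val j) \in pairs by rewrite pairsP /= ltij ltn_ord.
have lk : index (val i, val j) pairs < 10.
  by rewrite -[ltnRHS]/(size pairs) index_mem.
exists (index (val i, val j) pairs) => //.
by apply: val_inj; rewrite val_vertex // /pair nth_index //= !inord_val.
Qed.

Lemma vertex_adj a b : a < 10 -> b < 10 ->
  petersen_adj (vertex a) (vertex b) = linked a b.
Proof.
move=> la lb; rewrite /petersen_adj !val_vertex // disjoints_subset.
have := mem_nth (0, 1) (la : a < size pairs).
have := mem_nth (0, 1) (lb : b < size pairs).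
rewrite -/(pair a) -/(pair b) !pairsP => /andP[lb12 lb2] /andP[la12 la2].
have la1 := ltn_trans la12 la2; have lb1 := ltn_trans lb12 lb2.
rewrite subUset !sub1set !inE !eq_inord //.
apply/eqP; move: a b la lb {lb12 lb2 la12 la2 la1 lb1}.
(* Disjointness has become four inequalities between numbers, so the table [arcs] can be checked on
   all 100 pairs of indices. *)
have: all (fun a => all (fun b =>
  let p := pair a in let q := pair b in
  ~~ ((p.1 == q.1) || (p.1 == q.2)) && ~~ ((p.2 == q.1) || (p.2 == q.2))
    == linked a b)
  (iota 0 10)) (iota 0 10) by [].
by move=> /allP H a b la lb; apply: (allP (H a _)); rewrite mem_iota.
Qed.

Lemma vertex_inj : {in gtn 10 &, injective vertex}.
Proof.
move=> a b; rewrite !inE => la lb /(congr1 val); rewrite !val_vertex // => /eqP.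
have := mem_nth (0, 1) (la : a < size pairs).
have := mem_nth (0, 1) (lb : b < size pairs).
rewrite -/(pair a) -/(pair b) !pairsP => /andP[lb12 lb2] /andP[la12 la2].
have la1 := ltn_trans la12 la2; have lb1 := ltn_trans lb12 lb2.
rewrite eq_set2 !xpair_eqE !eq_inord // -!xpair_eqE -!surjective_pairing.
case/orP=> /eqP.
  by move/eqP; rewrite nth_uniq // => /eqP.
(* A crossed match would make a listed pair decreasing, whereas all of [pairs] is increasing. *)
move=> E; move: la12 lb12; rewrite -E /= => l1 l2.
by have := ltn_trans l1 l2; rewrite ltnn.
Qed.

Lemma arcs_lt p : p \in arcs -> p.1 < p.2 < 10.
Proof. by apply: (allP (_ : all (fun p => p.1 < p.2 < 10) arcs)). Qed.

Lemma edge_inj : {in arcs &, injective edge}.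
Proof.
move=> [a b] [c d] /arcs_lt/= /andP[ltab lb] /arcs_lt/= /andP[ltcd ld].
have [la lc] := (ltn_trans ltab lb, ltn_trans ltcd ld).
move/eqP; rewrite eq_set2 => /orP[] /eqP[].
  by move=> /(vertex_inj la lc)-> /(vertex_inj lb ld)->.
move=> /(vertex_inj lb lc) Ebc /(vertex_inj la ld) Ead.
by move: ltab; rewrite Ebc Ead ltnNge ltnW.
Qed.

Lemma petersen_edgesP e :
  reflect (exists2 p, p \in arcs & e = edge p) (e \in petersen_edges).
Proof.
apply: (iffP imsetP) => [[[u v]]|[p pA ->]].
  rewrite inE /=; have [i li ->] := vertexP u; have [j lj ->] := vertexP v.
  rewrite vertex_adj // => /orP[] ijA ->; first by exists (i, j).
  by exists (j, i); rewrite // setUC.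
have /andP[l12 l2] := arcs_lt pA.
exists (vertex p.1, vertex p.2) => //; rewrite inE /= vertex_adj //.
  by rewrite /linked -surjective_pairing pA.
exact: ltn_trans l2.
Qed.

(** Filtering keeps the order of [arcs], so each set of edges has exactly one list and can be looked
    up among enumerated sublists. *)
Definition arcs_in (D : {set {set petersen_vertex}}) :=
  [seq p <- arcs | edge p \in D].

Lemma size_arcs_in (D : {set {set petersen_vertex}}) :
  D \subset petersen_edges -> size (arcs_in D) = #|D|.
Proof.
move=> /subsetP DE; have injD : {in arcs_in D &, injective edge}.
  move=> p q; rewrite !mem_filter => /andP[_ pA] /andP[_ qA].
  exact: edge_inj.
rewrite -(size_map edge) -(card_uniqP _); last first.
  by rewrite map_inj_in_uniq ?filter_uniq.
apply: eq_card => e; apply/mapP/idP => [[p + ->]|eD].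
  by rewrite mem_filter => /andP[].
have /petersen_edgesP[p pA e_p] := DE e eD.
by exists p; rewrite // mem_filter -e_p eD.
Qed.

Lemma colouring_arcs (T : eqType) S (f : petersen_vertex -> T) :
    edges S = petersen_edges ->
  colouring S f <->
  {in arcs, forall p,
    (edge p \notin negative S) = (f (vertex p.1) == f (vertex p.2))}.
Proof.
move=> SE; split=> [fS p pA | fS u v].
  by apply: fS; rewrite SE; apply/petersen_edgesP; exists p.
rewrite SE => /petersen_edgesP[p pA uv_p]; rewrite uv_p fS //.
move/eqP: uv_p; rewrite eq_set2 => /orP[] /eqP[-> ->].
  by [].
by rewrite eq_sym.
Qed.

(** * Exhaustive search for colourings *)

Section Search.
Variable pos : pred (nat * nat).

(** The vertex being coloured is [size c]. Arcs are increasing, so those ending there start at an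
    already coloured vertex, and each arc is tested exactly once, at its larger end. *)
Definition compatible (c : seq nat) x :=
  all (fun p => pos p == (nth 0 c p.1 == x)) [seq p <- arcs | p.2 == size c].

Fixpoint colourings k n : seq (seq nat) :=
  if n is n'.+1 then
    [seq rcons c x | c <- colourings k n',
                     x <- [seq x <- iota 0 k | compatible c x]]
  else [:: [::]].

Definition proper k n (h : nat -> nat) :=
  {in gtn n, forall i, h i < k} /\
  {in arcs, forall p, p.2 < n -> pos p = (h p.1 == h p.2)}.

(** Completeness of the search: an empty result excludes every colouring. *)
Lemma proper_colourings k n h : proper k n h -> mkseq h n \in colourings k n.
Proof.
elim: n => [|n IHn] [ltk hP] //; rewrite mkseqS; apply/allpairsPdep.
exists (mkseq h n), (h n); split=> //.
  apply: IHn; split=> [i lt_in|p pA lt_pn]; first exact/ltk/leqW.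
  exact/hP/leqW.
rewrite mem_filter mem_iota /= add0n ltk ?inE // andbT.
apply/allP=> p; rewrite mem_filter size_mkseq => /andP[/eqP p2n pA].
have /andP[lt12 _] := arcs_lt pA.
by rewrite nth_mkseq -?p2n // hP // p2n.
Qed.

(** Soundness of the search: a nonempty result yields an actual colouring. *)
Lemma colourings_proper k n c :
  c \in colourings k n -> size c = n /\ proper k n (nth 0 c).
Proof.
elim: n c => [|n IHn] c.
  by rewrite inE => /eqP->; do 2?split.
case/allpairsPdep=> [c' [x [/IHn[c'n [ltk c'P]]]]].
rewrite mem_filter mem_iota /= add0n => /andP[/allP cx ltxk] ->.
rewrite size_rcons c'n; split=> //; split=> [i|p pA]; rewrite !nth_rcons c'n.
  rewrite inE ltnS leq_eqVlt => /predU1P[->|ltin]; first by rewrite ltnn eqxx.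
  by rewrite ltin ltk.
have /andP[lt12 _] := arcs_lt pA.
rewrite ltnS leq_eqVlt => /predU1P[p2n|lt2n].
  have /cx/eqP-> : p \in [seq p <- arcs | p.2 == size c'].
    by rewrite mem_filter c'n p2n eqxx.
  by rewrite -p2n lt12 ltnn eqxx.
by rewrite lt2n (ltn_trans lt12) // c'P.
Qed.

(** Refuting [k.-1] colours refutes every smaller number too, since a colouring with [m < k] colours
    takes its values below [k.-1]. *)
Lemma clu_petersen S k :
    edges S = petersen_edges ->
    {in arcs, forall p, (edge p \notin negative S) = pos p} ->
    colourings k 10 != [::] -> colourings k.-1 10 = [::] ->
  clusterable S /\ clu S = k.
Proof.
move=> SE posP; case Dc: (colourings k 10) => [//|c cs] _ no_col.
have [_ [ltk cP]] : size c = 10 /\ proper k 10 (nth 0 c).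
  by apply: colourings_proper; rewrite Dc mem_head.
apply: clu_colouring => [|m f lt_mk /(colouring_arcs f SE) fS].
  (* The inverse of the numbering: the position of a vertex in the list of all ten. *)
  have [code codeK] : exists code, forall i, i < 10 -> code (vertex i) = i.
    exists (fun v => index v (mkseq vertex 10)) => i lti.
    rewrite -(nth_mkseq vertex0 vertex lti) index_uniq ?size_mkseq //.
    by apply/mkseq_uniqP=> a b; apply: vertex_inj.
  have ltk' v : nth 0 c (code v) < k.
    by have [i lti ->] := vertexP v; rewrite codeK // ltk.
  exists (fun v => Ordinal (ltk' v)); apply/(colouring_arcs _ SE) => p pA.
  have /andP[lt12 lt2] := arcs_lt pA.
  by rewrite posP // cP // -val_eqE /= !codeK // (ltn_trans lt12).
suffices: mkseq (fun i => val (f (vertex i))) 10 \in colourings k.-1 10.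
  by rewrite no_col.
apply: proper_colourings; split=> [i _|p pA _]; last by rewrite -posP // fS.
by rewrite (leq_trans (ltn_ord _)) // -ltnS (ltn_predK lt_mk).
Qed.

End Search.

(** * Positive components and lower bounds for Q *)

(** The length bound prunes during generation, which avoids listing all 2^15 sets of edges. *)
Fixpoint small_subseqs (T : Type) m (s : seq T) : seq (seq T) :=
  if s is x :: s' then
    small_subseqs m s' ++
    (if m is m'.+1 then map (cons x) (small_subseqs m' s') else [::])
  else [:: [::]].

Lemma mem_small_subseqs (T : eqType) m (s : seq T) a :
  size (filter a s) <= m -> filter a s \in small_subseqs m s.
Proof.
elim: s m => [|x s IHs] //= m; rewrite mem_cat.
case: (a x) => [|/IHs-> //]; case: m => // m /IHs le_m.
by rewrite orbC map_f.
Qed.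

Definition merge_arc (l : seq nat) (p : nat * nat) :=
  [seq if x == nth 0 l p.1 then nth 0 l p.2 else x | x <- l].

(* Label i of the result names the component of vertex i in the graph with
   arcs [ps]. *)
Definition components (ps : seq (nat * nat)) := foldl merge_arc (iota 0 10) ps.

(** A merge makes two labels equal only if they were equal before or were the labels of the two ends
    of the new arc, where [g] agrees. With [g] the block of a vertex, equal labels mean a common
    cluster. *)
Lemma components_const (T : eqType) (g : nat -> T) ps :
    {subset ps <= arcs} -> {in ps, forall p, g p.1 = g p.2} ->
  {in gtn 10 &, forall i j,
    nth 0 (components ps) i = nth 0 (components ps) j -> g i = g j}.
Proof.
have size_c qs : size (components qs) = 10.
  by elim/last_ind: qs => // qs q; rewrite /components foldl_rcons size_map.
elim/last_ind: ps => [|ps p IHps] sub gP i j lti ltj.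
  by rewrite !nth_iota // !add0n => ->.
have subP : {subset ps <= arcs}.
  by move=> q qs; apply: sub; rewrite mem_rcons inE qs orbT.
have gP' : {in ps, forall q, g q.1 = g q.2}.
  by move=> q qs; apply: gP; rewrite mem_rcons inE qs orbT.
have {}IHps := IHps subP gP'.
have pP : p \in rcons ps p by rewrite mem_rcons mem_head.
have g12 := gP p pP.
have /andP[lt12 lt2] := arcs_lt (sub p pP); have lt1 := ltn_trans lt12 lt2.
rewrite /components foldl_rcons -/(components ps).
rewrite !(nth_map 0) ?size_c //.
case: eqP => [/IHps-> // | _]; case: eqP => [/IHps-> // | _] //.
- by move=> /IHps<- //; rewrite g12.
- by move=> /IHps-> //; rewrite g12.
- exact: IHps.
Qed.

(** With [N] the negative arcs and [d] the deleted ones, this detects a remaining cycle with exactly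
    one negative edge, the classical obstruction to clusterability. *)
Definition unbalanced (N d : seq (nat * nat)) :=
  let l := components [seq p <- arcs | (p \notin N) && (p \notin d)] in
  has (fun p => (p \notin d) && (nth 0 l p.1 == nth 0 l p.2)) N.

Lemma mem_arcs_in (D : {set {set petersen_vertex}}) p :
  p \in arcs -> (p \in arcs_in D) = (edge p \in D).
Proof. by rewrite mem_filter => ->; rewrite andbT. Qed.

(** Blocks are constant along positive edges, so the two ends of the offending negative edge would
    share a block. *)
Lemma unbalanced_delete S D :
    edges S = petersen_edges ->
    unbalanced (arcs_in (negative S)) (arcs_in D) ->
  ~~ clusterable (delete S D).
Proof.
move=> SE /hasP[p pN /andP[pD /eqP linked_p]]; apply/existsP=> -[C CS].
have pA : p \in arcs by move: pN; rewrite mem_filter => /andP[].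
have {}CS q : q \in arcs -> q \notin arcs_in D ->
    (edge q \notin negative S)
    = (pblock C (vertex q.1) == pblock C (vertex q.2)).
  move=> qA; rewrite mem_arcs_in // => qD.
  have := clustering_pblock CS (u := vertex q.1) (v := vertex q.2).
  rewrite /= -/(edge q) !inE qD /= SE => <- //.
  by apply/petersen_edgesP; exists q.
have /andP[lt12 lt2] := arcs_lt pA.
have := CS p pA pD; rewrite -mem_arcs_in // pN => /esym/negP; apply; apply/eqP.
apply: (components_const (g := pblock C \o vertex) _ _ _ _ linked_p) => //.
- by move=> q; rewrite mem_filter => /andP[].
- move=> q; rewrite mem_filter => /andP[/andP[qN qD] qA] /=.
  by apply/eqP; rewrite -CS // -mem_arcs_in.
- exact: ltn_trans lt2.
Qed.

(** [mem N] marks the positive edges of the negated graph, so the two colouring clauses determine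
    the cluster number of [negate S], while the last clause bounds Q of [S] from below. *)
Definition certificate k (N : seq (nat * nat)) :=
  [&& 0 < size N, colourings (mem N) k 10 != [::],
      colourings (mem N) k.-1 10 == [::]
    & all (unbalanced N) (small_subseqs (size N).-1 arcs)].

Lemma certificateP S k (N := arcs_in (negative S)) :
    edges S = petersen_edges -> certificate k N ->
  [/\ ~~ clusterable S, clusterable (negate S), clu (negate S) = k,
      inclusterability S = size N & inclusterability (negate S) = 0].
Proof.
move=> SE /and4P[N_gt0 col_k /eqP no_col /allP unbal].
have negE : negative S \subset petersen_edges by rewrite -SE negative_sub.
have [clN cluN] : clusterable (negate S) /\ clu (negate S) = k.
  apply: clu_petersen col_k no_col => // p pA.
  have pE : edge p \in petersen_edges by apply/petersen_edgesP; exists p.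
  by rewrite /= !inE negb_and negbK /N mem_arcs_in // SE pE orbF.
have QS : inclusterability S = size N.
  apply/eqP; rewrite eqn_leq [size N]size_arcs_in // inclusterability_negative.
  (* A minimum deletion set smaller than [N] would be among the enumerated sublists, all of which
     leave an obstruction. *)
  have [[D [DE DS <-]] _] := inclusterabilityP S; rewrite SE in DE.
  rewrite -!size_arcs_in // leqNgt; apply/negP=> ltDN.
  suffices: ~~ clusterable (delete S D) by rewrite DS.
  apply: unbalanced_delete => //; apply/unbal/mem_small_subseqs.
  by rewrite -ltnS (ltn_predK ltDN).
split=> //; first by rewrite clusterable_inclusterability QS -lt0n.
by apply/eqP; rewrite -clusterable_inclusterability.
Qed.

(** * Edge distance in terms of arcs *)

Definition meets (p q : nat * nat) :=
  has (fun i => i \in [:: q.1; q.2]) [:: p.1; p.2].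

(** On arcs this is edge distance at most 2: [r] may equal [p] or [q], which covers arcs that meet
    or coincide. *)
Definition joined p q := has (fun r => meets p r && meets r q) arcs.

Lemma meets_edge p q : meets p q -> edge p :&: edge q != set0.
Proof.
case/hasP=> i; rewrite !inE => ip iq; apply/set0Pn; exists (vertex i).
rewrite !inE; case/orP: ip => /eqP<-; case/orP: iq => /eqP<-.
all: by rewrite eqxx ?orbT.
Qed.

Section Distance.
Variables (V : finType) (E : {set {set V}}).

Lemma edge_distance_le1 e f :
  e \in E -> f \in E -> e :&: f != set0 -> edge_distance E e f <= 1.
Proof.
(* [line_adj] is irreflexive, so coinciding edges need the empty walk. *)
move=> eE fE ef; have [<-|neq_ef] := eqVneq e f.
  exact: leq_trans (@graph_distance_le _ (line_adj E) e [::] isT) _.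
apply: (@graph_distance_le _ (line_adj E) e [:: f]).
by rewrite /= /line_adj eE fE neq_ef ef.
Qed.

Lemma edge_distance_le2 e f g :
    e \in E -> f \in E -> g \in E -> e :&: g != set0 -> g :&: f != set0 ->
  edge_distance E e f <= 2.
Proof.
move=> eE fE gE eg gf.
have [e_g|neq_eg] := eqVneq e g.
  by rewrite leqW // edge_distance_le1 // e_g.
have [g_f|neq_gf] := eqVneq g f.
  by rewrite leqW // edge_distance_le1 // -g_f.
apply: (@graph_distance_le _ (line_adj E) e [:: g; f]).
by rewrite /= /line_adj eE fE gE neq_eg neq_gf eg gf.
Qed.

End Distance.

(** * Enumeration of the possible negative sets *)

Definition separated (r : rel (nat * nat)) (N : seq (nat * nat)) :=
  allrel (fun p q => (p == q) || ~~ r p q) N N.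

(** Distances are not computed: distance above 1 excludes [meets], distance above 2 excludes
    [joined], and every set that passes is tested, without appeal to the automorphisms of P. *)
Definition separated_sets m r :=
  [seq N <- small_subseqs m arcs | (size N == m) && separated r N].

Lemma arcs_in_separated m r (D : {set {set petersen_vertex}}) :
    D \subset petersen_edges -> #|D| = m ->
    {in arcs_in D &, forall p q, edge p != edge q -> ~~ r p q} ->
  arcs_in D \in separated_sets m r.
Proof.
move=> DE Dm rP; rewrite mem_filter mem_small_subseqs -/(arcs_in D);
  last by rewrite size_arcs_in ?Dm.
rewrite size_arcs_in // Dm eqxx andbT; apply/allrelP=> p q pD qD /=.
have [//|neq_pq] := eqVneq p q; apply: rP => //; apply: contraNneq neq_pq.
by move: pD qD; rewrite !mem_filter => /andP[_ pA] /andP[_ qA] /edge_inj->.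
Qed.

Fixpoint simple_paths n : seq (seq nat) :=
  if n is n'.+1 then
    [seq i :: s | s <- simple_paths n',
                  i <- [seq i <- iota 0 10 | path linked i s && (i \notin s)]]
  else [:: [::]].

Lemma mem_simple_paths s :
  all (gtn 10) s -> sorted linked s -> uniq s -> s \in simple_paths (size s).
Proof.
elim: s => // i s IHs /andP[lti lts] i_s /andP[s'i us]; apply/allpairsPdep.
exists s, i; split=> //; first by rewrite IHs // (path_sorted i_s).
by rewrite mem_filter [path _ _ _]i_s s'i mem_iota.
Qed.

(** Each 6-cycle occurs twelve times, once per starting vertex and direction. *)
Definition hexagons := [seq s <- simple_paths 6 | cycle linked s].

(* Sorted as in [arcs], so that hexagons with the same alternate edges give the
   same list. *)
Definition alternate_arcs s :=
  let A := [:: (nth 0 s 0, nth 0 s 1); (nth 0 s 2, nth 0 s 3);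
               (nth 0 s 4, nth 0 s 5)] in
  [seq p <- arcs | (p \in A) || ((p.2, p.1) \in A)].

Lemma P32_arcs S :
  is_P32 S -> arcs_in (negative S) \in undup (map alternate_arcs hexagons).
Proof.
case=> SE [a [b [c [d [e [f []]]]]]].
have [ia la ->] := vertexP a; have [ib lb ->] := vertexP b.
have [ic lc ->] := vertexP c; have [id ld ->] := vertexP d.
have [ie le ->] := vertexP e; have [jf lf ->] := vertexP f.
set s := [:: ia; ib; ic; id; ie; jf].
have lts : all (gtn 10) s by rewrite /= la lb lc ld le lf.
rewrite -[[:: _; _; _; _; _; _]]/(map vertex s) => /andP[cyc_s uniq_s] negS.
have {}uniq_s : uniq s by apply: map_uniq uniq_s.
have {}cyc_s : cycle linked s by move: cyc_s; rewrite /= !vertex_adj.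
rewrite mem_undup; apply/mapP; exists s.
  rewrite mem_filter cyc_s (@mem_simple_paths s) //.
  by move: cyc_s; rewrite /= => /and5P[-> -> -> -> /andP[->]].
apply: eq_in_filter => -[p q] /arcs_lt/= /andP[ltpq ltq].
have ltp := ltn_trans ltpq ltq.
have eq_vertex i j : i < 10 -> j < 10 -> (vertex i == vertex j) = (i == j).
  by move=> lti ltj; apply/eqP/eqP=> [/vertex_inj-> //|->].
rewrite negS !inE /edge !eq_set2 !xpair_eqE /= !eq_vertex //.
(* Both sides are disjunctions of the same six conditions: three edges, each in two orientations. *)
by do 6!case: (_ && _).
Qed.

Lemma certificate1 : all (certificate 3) (separated_sets 1 meets).
Proof. by vm_compute. Qed.

(** All pairs of disjoint edges are tested together, so distances 2 and 3 are both covered. *)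
Lemma certificate2 : all (certificate 3) (separated_sets 2 meets).
Proof. by vm_compute. Qed.

Lemma certificate33 : all (certificate 2) (separated_sets 3 joined).
Proof. by vm_compute. Qed.

Lemma certificate32 :
  all (certificate 4) (undup (map alternate_arcs hexagons)).
Proof. by vm_compute. Qed.

(** Turns the value [size N] of Q into 3; for the other families the length is built into
    [separated_sets]. *)
Lemma size32 : all (fun N => size N == 3) (undup (map alternate_arcs hexagons)).
Proof. by vm_compute. Qed.

(** * Each signature type falls in its enumerated list *)

Lemma negative_petersen (S : signed_graph petersen_vertex) :
  edges S = petersen_edges -> negative S \subset petersen_edges.
Proof. by move=> <-; apply: negative_sub. Qed.

Lemma edge_arcs_in (D : {set {set petersen_vertex}}) p :
  p \in arcs_in D -> edge p \in D.
Proof. by rewrite mem_filter => /andP[]. Qed.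

Lemma P1_arcs S : is_P1 S -> arcs_in (negative S) \in separated_sets 1 meets.
Proof.
case=> SE cardN; apply: arcs_in_separated => //; first exact: negative_petersen.
move=> p q /edge_arcs_in pN /edge_arcs_in qN.
have /cards1P[e N_e] := introT eqP cardN; move: pN qN.
by rewrite N_e !inE => /eqP-> /eqP->; rewrite eqxx.
Qed.

Lemma P2_arcs S d :
  1 < d -> is_P2 S d -> arcs_in (negative S) \in separated_sets 2 meets.
Proof.
move=> lt1d [SE [e [f [N_ef neq_ef dist_ef]]]]; have NE := negative_petersen SE.
apply: arcs_in_separated => //; first by rewrite N_ef cards2 neq_ef.
have [eE fE] : e \in petersen_edges /\ f \in petersen_edges.
  by split; apply: (subsetP NE); rewrite N_ef !inE eqxx ?orbT.
(* Edges with a common vertex are at distance at most 1, below [d]. *)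
have ef0 : e :&: f == set0.
  by apply: contraTT lt1d => ef; rewrite -leqNgt -dist_ef edge_distance_le1.
move=> p q /edge_arcs_in pN /edge_arcs_in qN neq_pq.
apply/negP=> /meets_edge; move: pN qN neq_pq; rewrite N_ef !inE.
by case/orP=> /eqP-> /orP[] /eqP->; rewrite ?eqxx ?[f :&: e]setIC ?ef0.
Qed.

Lemma P33_arcs S : is_P33 S -> arcs_in (negative S) \in separated_sets 3 joined.
Proof.
case=> SE [cardN distN]; have NE := negative_petersen SE.
apply: arcs_in_separated => // p q /edge_arcs_in pN /edge_arcs_in qN neq_pq.
apply/negP=> /hasP[r rA /andP[/meets_edge pr /meets_edge rq]].
(* The arc [r] gives a walk of length at most 2, against distance 3. *)
suffices: edge_distance petersen_edges (edge p) (edge q) <= 2 by rewrite distN.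
apply: edge_distance_le2 pr rq; try exact: (subsetP NE).
by apply/petersen_edgesP; exists r.
Qed.

Lemma size_separated m r N : N \in separated_sets m r -> size N = m.
Proof. by rewrite mem_filter => /andP[/andP[/eqP]]. Qed.

Theorem theorem10p4
    (P1 P22 P23 P32 P33 : signed_graph petersen_vertex)
    (hP1 : is_P1 P1) (hP22 : is_P2 P22 2) (hP23 : is_P2 P23 3)
    (hP32 : is_P32 P32) (hP33 : is_P33 P33) :
  (* clusterability and cluster numbers *)
  [/\ clusterable plusP, clusterable minusP, clu plusP = 1 & clu minusP = 3] /\
  [/\ ~~ clusterable P1, ~~ clusterable P22, ~~ clusterable P23,
      ~~ clusterable P32 & ~~ clusterable P33] /\
  [/\ clusterable (negate P1), clusterable (negate P22),
      clusterable (negate P23), clusterable (negate P32)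
    & clusterable (negate P33)] /\
  [/\ clu (negate P1) = 3, clu (negate P22) = 3, clu (negate P23) = 3,
      clu (negate P32) = 4 & clu (negate P33) = 2] /\
  (* inclusterability indices *)
  (inclusterability plusP = 0 /\ inclusterability minusP = 0) /\
  [/\ inclusterability P1 = 1, inclusterability P22 = 2,
      inclusterability P23 = 2, inclusterability P32 = 3
    & inclusterability P33 = 3] /\
  [/\ inclusterability (negate P1) = 0, inclusterability (negate P22) = 0,
      inclusterability (negate P23) = 0, inclusterability (negate P32) = 0
    & inclusterability (negate P33) = 0].
Proof.
have [E1 E22 E23 E32 E33] :
    [/\ edges P1 = petersen_edges, edges P22 = petersen_edges,
        edges P23 = petersen_edges, edges P32 = petersen_edges
      & edges P33 = petersen_edges].
  by split; [case: hP1 | case: hP22 | case: hP23 | case: hP32 | case: hP33].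
have A1 := P1_arcs hP1; have A33 := P33_arcs hP33; have A32 := P32_arcs hP32.
have A22 := P2_arcs (isT : 1 < 2) hP22; have A23 := P2_arcs (isT : 1 < 3) hP23.
have [-> -> -> -> ->] := certificateP E1 (allP certificate1 _ A1).
have [-> -> -> -> ->] := certificateP E22 (allP certificate2 _ A22).
have [-> -> -> -> ->] := certificateP E23 (allP certificate2 _ A23).
have [-> -> -> -> ->] := certificateP E32 (allP certificate32 _ A32).
have [-> -> -> -> ->] := certificateP E33 (allP certificate33 _ A33).
rewrite (size_separated A1) (size_separated A22) (size_separated A23).
rewrite (size_separated A33) (eqP (allP size32 _ A32)).
have [clus_p ->] : clusterable plusP /\ clu plusP = 1.
  apply: (@clu_petersen xpredT plusP 1 erefl); [|by vm_compute|by vm_compute].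
  by move=> p _; rewrite inE.
(* With every edge negative, the colourings are the proper vertex colourings of P, so 3 is its
   chromatic number. *)
have [clus_m ->] : clusterable minusP /\ clu minusP = 3.
  apply: (@clu_petersen xpred0 minusP 3 erefl); [|by vm_compute|by vm_compute].
  by move=> p pA; apply/negbF/petersen_edgesP; exists p.
move: (clus_p) (clus_m); rewrite !clusterable_inclusterability.
move=> /eqP-> /eqP->.
by repeat split.
Qed.
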